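(* Let $(\Omega,\Sigma,\mathbb{P})$ be a nonatomic probability space. Let $\mathcal{K}$ be a convex bounded subset of $\mathbb{L}^1(\mathbb{P})$ and let $\mathcal{S}$ be a nonempty subset of $\mathbb{L}^1(\mathbb{P})$. The following are equivalent. (1) There exists a probability measure $\mathbb{Q}\sim\mathbb{P}$ such that if $(X_n)$ is a sequence in $\mathcal{K}$ that converges in probability to some $X\in\mathcal{S}$, then $(X_n)$ converges to $X$ in $\mathbb{L}^1(\mathbb{Q})$. (2) For any $\varepsilon>0$, there exists a measurable set $A$ with $\mathbb{P}(A)>1-\varepsilon$ such that if $(X_n)$ is a sequence in $\mathcal{K}$ that converges in probability to some $X\in\mathcal{S}$, then $\mathbb{E}_{\mathbb{P}}[|X_n-X|\mathbf{1}_A]\to 0$. (3) For any measurable set $A$ with $\mathbb{P}(A)>0$, there exists a measurable subset $B$ of $A$ with $\mathbb{P}(B)>0$ such that if $(X_n)$ is a sequence in $\mathcal{K}$ that converges in probability to some $X\in\mathcal{S}$, then $\mathbb{E}_{\mathbb{P}}[|X_n-X|\mathbf{1}_B]\to 0$.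
   Context: Bounded in $\mathbb{L}^1(\mathbb{P})$ means $\sup_{X\in\mathcal{K}}\mathbb{E}_{\mathbb{P}}[|X|]<\infty$. $\mathbb{Q}\sim\mathbb{P}$ means that $\mathbb{Q}$ is a probability measure on $(\Omega,\Sigma)$ mutually absolutely continuous with $\mathbb{P}$. Convergence of $(X_n)$ to $X$ in $\mathbb{L}^1(\mathbb{Q})$ means $\mathbb{E}_{\mathbb{Q}}[|X_n-X|]\to 0$. *)

(* Defs.v *)
From HB Require Import structures.
From mathcomp Require Import all_boot all_order all_algebra.
From mathcomp Require Import all_classical all_reals all_analysis.

Set Implicit Arguments.
Unset Strict Implicit.
Unset Printing Implicit Defensive.
Import Order.TTheory GRing.Theory Num.Theory.
Import numFieldNormedType.Exports.

Local Open Scope classical_set_scope.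
Local Open Scope ring_scope.

Definition nonatomic (d : measure_display) (T : measurableType d)
    (R : realType) (P : probability T R) : Prop :=
  forall A : set T, measurable A -> (0 < P A)%E ->
    exists B : set T,
      [/\ measurable B, B `<=` A, (0 < P B)%E & (P B < P A)%E].

Definition cvg_in_probability (d : measure_display) (T : measurableType d)
    (R : realType) (P : probability T R) (X_ : nat -> T -> R) (X : T -> R)
    : Prop :=
  forall e : R, 0 < e ->
    (fun n => P [set w | e <= `|X_ n w - X w|]) @ \oo --> 0%E.

Definition mutually_ac (d : measure_display) (T : measurableType d)
    (R : realType) (Q P : probability T R) : Prop :=
  Q `<< P /\ P `<< Q.

(* [LspaceType1 P] is the quotient of the P-integrable functions by P-a.e.
   equality; it carries no module structure in the library, so the convex
   combination [t X + (1 - t) Y] is the class Z characterized by P-a.e.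
   equality. *)
Definition L1_convex (d : measure_display) (T : measurableType d)
    (R : realType) (P : probability T R) (K : set (LspaceType1 P)) : Prop :=
  forall (X Y Z : LspaceType1 P) (t : R), K X -> K Y -> 0 <= t <= 1 ->
    {ae P, forall w, (Z w : R) = t * (X w : R) + (1 - t) * (Y w : R)} -> K Z.

Definition L1_bounded (d : measure_display) (T : measurableType d)
    (R : realType) (P : probability T R) (K : set (LspaceType1 P)) : Prop :=
  (ereal_sup [set 'E_P[(fun w => `|(X w : R)|)%R] | X in K] < +oo)%E.

(* Main.v *)
(* (1) => (2): cut the density dP/dQ at a high level N; on A = {dP/dQ <= N} one
   has E_P[f 1_A] <= N E_Q[f].
   (2) => (3): take e = P(A) in (2) and intersect the resulting set with A.
   (3) => (1): the sets on which the restricted convergence holds are stable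
   under disjoint unions, so by exhaustion countably many of them, A_k, cover
   the space up to a null set.  Let Q be proportional to
   sum_k 2^-(k+1) P(. /\ A_k).  The k-th term of
   E_Q[|X_n - X|] tends to 0 and is at most a multiple of 2^-(k+1) sup_n
   E_P[|X_n - X|], which is finite as K is bounded, so dominated convergence
   for series applies. *)
Require Import Defs.
From HB Require Import structures.
From mathcomp Require Import all_boot all_order all_algebra.
From mathcomp Require Import all_classical all_reals all_analysis.
From mathcomp Require Import measurable_realfun.

Set Implicit Arguments.
Unset Strict Implicit.
Unset Printing Implicit Defensive.
Import Order.TTheory GRing.Theory Num.Theory.
Import numFieldNormedType.Exports.

Local Open Scope classical_set_scope.
Local Open Scope ring_scope.

(** The complement of [D] is null for the restricted measure, and on subsets of [D] the two measures
    agree. *)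
Lemma integral_mrestr (d : measure_display) (T : measurableType d)
    (R : realType) (mu : {measure set T -> \bar R}) (D : set T)
    (mD : measurable D) (f : T -> \bar R) :
  measurable_fun [set: T] f -> (forall x, (0 <= f x)%E) ->
  (\int[mrestr mu mD]_x f x = \int[mu]_(x in D) f x)%E.
Proof.
move=> mf f0; rewrite -(setvU D) ge0_integral_setU//.
- rewrite null_set_integral ?add0e//.
  + apply: eq_measure_integral => A mA AD.
    by rewrite -[in RHS](setIidl AD).
  + exact: measurableC.
  + exact: measurable_funTS.
  + by rewrite -[LHS]/(mu (~` D `&` D)) setICl measure0.
- exact: measurableC.
- exact: measurable_funTS.
- exact/disj_setPCr.
Qed.

(** A nonnegative series is an integral against the counting measure on [nat], so Lebesgue's
    dominated convergence theorem applies. *)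
Lemma nneseries_dominated_cvg0 (R : realType) (a : nat -> nat -> \bar R)
    (g : nat -> \bar R) :
  (forall n k, 0 <= a n k <= g k)%E -> (\sum_(k <oo) g k < +oo)%E ->
  (forall k, a ^~ k @ \oo --> 0%E) ->
  (fun n => \sum_(k <oo) a n k)%E @ \oo --> 0%E.
Proof.
move=> ag goo a0.
have g0 k : (0 <= g k)%E by have /andP[] := ag 0%N k; exact: le_trans.
have [|||||_ _] := @dominated_convergence _ nat R counting setT measurableT
  a (cst 0%E) g.
- by move=> n.
- exact: measurable_cst.
- by apply: aeW => k _; exact: a0.
- apply/integrableP; split => //.
  under eq_integral do rewrite gee0_abs//.
  by rewrite ge0_integral_count.
- by apply: aeW => k n _; have /andP[? ?] := ag n k; rewrite gee0_abs.
rewrite integral0; apply: cvg_trans; apply: near_eq_cvg; apply: nearW => n /=.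
by rewrite ge0_integral_count// => k; have /andP[] := ag n k.
Qed.

(** Choose [A_ n] in [G] with measure within 1/(n+1) of the supremum [s]. If the union missed a set
    of positive measure, that set would contain some [B] in [G] with [P B > 0]; once 1/(n+1) <
    [P B], the disjoint union of [A_ n] and [B] lies in [G] and has measure above [s]. The sets
    [A_ n] may overlap. *)
Lemma exhaustion (d : measure_display) (T : measurableType d) (R : realType)
    (P : {finite_measure set T -> \bar R}) (G : set (set T)) :
  G `<=` measurable -> G set0 ->
  (forall A B, G A -> G B -> A `&` B = set0 -> G (A `|` B)) ->
  (forall A, measurable A -> (0 < P A)%E ->
    exists B, [/\ G B, B `<=` A & (0 < P B)%E]) ->
  exists A_ : nat -> set T, (forall n, G (A_ n)) /\ P (~` \bigcup_n A_ n) = 0%E.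
Proof.
move=> mG G0 GU GB; pose s := ereal_sup [set P A | A in G].
have fin_s : s \is a fin_num.
  rewrite ge0_fin_numE; last by apply: ereal_sup_ubound; exists set0.
  apply: (@le_lt_trans _ _ (P setT)); last by rewrite -ge0_fin_numE// fin_num_measure.
  by apply: ge_ereal_sup => _ [A GA <-]; rewrite le_measure ?inE//; exact: mG.
have exA n : exists A, G A /\ (s - (n.+1%:R^-1)%:E < P A)%E.
  have [] := @ub_ereal_sup_adherent R [set P A | A in G] n.+1%:R^-1 _ fin_s.
    by rewrite invr_gt0.
  by move=> _ [A GA <-] ?; exists A.
have [A_ A_P] := choice exA; exists A_; split; first by move=> n; have [] := A_P n.
have mA n : measurable (A_ n) by apply: mG; have [] := A_P n.
apply/eqP; rewrite eq_le measure_ge0 andbT leNgt; apply/negP => PC.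
have [|B [GB' BC PB]] := GB _ _ PC; first exact/measurableC/bigcup_measurable.
have finB : P B \is a fin_num by rewrite fin_num_measure//; exact: mG.
have PB0 : 0 < fine (P B) by rewrite fine_gt0// PB -ge0_fin_numE.
have [n nB] : exists n, n.+1%:R^-1 < fine (P B).
  have [n _ /(_ n (leqnn n))] := near_infty_natSinv_lt (PosNum PB0).
  by exists n.
have [GAn] := A_P n; rewrite ltNge => /negP; apply.
have AB : A_ n `&` B = set0.
  by apply/disjoints_subset => x Ax /BC; apply; exists n.
have : (P (A_ n) + P B <= s)%E.
  rewrite -measureU//; last exact: mG.
  by apply: ereal_sup_ubound; exists (A_ n `|` B) => //; apply: GU.
move: (mA n) => /(fin_num_measure P) finA.
rewrite -(fineK finA) -(fineK finB) -(fineK fin_s) -EFinD -EFinB !lee_fin => h.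
rewrite lerBrDr (le_trans _ h)// lerD2l; exact: ltW.
Qed.

(** [Q] is built from the sets [A_ k] alone, before any [f] is given; this is what yields one
    measure for all sequences at once. The uniform bound [M] on the integrals makes the weights,
    multiplied by [M], a summable dominating series. *)
Lemma equivalent_mixture (d : measure_display) (T : measurableType d)
    (R : realType) (P : probability T R) (A_ : nat -> set T) :
  (forall k, measurable (A_ k)) -> P (~` \bigcup_k A_ k) = 0%E ->
  exists Q : probability T R, mutually_ac Q P /\
    forall f : nat -> T -> \bar R,
      (forall n, measurable_fun [set: T] (f n)) -> (forall n x, 0 <= f n x)%E ->
      (exists M : R, forall n, \int[P]_x f n x <= M%:E)%E ->
      (forall k, (fun n => \int[P]_(x in A_ k) f n x)%E @ \oo --> 0%E) ->
      (fun n => \int[Q]_x f n x)%E @ \oo --> 0%E.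
Proof.
move=> mA PA0.
(* The weights 2^-(k+1), in the form of [cvg_geometric_eseries_half], so that their sum is 1. *)
have c_ge0 (k : nat) : (0 : R) <= 1 / (2 ^ (k + 1))%:R by rewrite divr_ge0.
pose c k : {nonneg R} := NngNum (c_ge0 k).
pose mu_ k : {measure set T -> \bar R} := mscale (c k) (mrestr P (mA k)).
pose mu : {measure set T -> \bar R} := mseries mu_ 0.
have sumc : (\sum_(k <oo) (c k)%:num%:E = 1)%E.
  have := @cvg_geometric_eseries_half R 1 0; rewrite expr0 divr1.
  by move/cvg_lim => <-.
have muE B : mu B = (\sum_(k <oo) (c k)%:num%:E * P (B `&` A_ k))%E by [].
(* As the weights sum to 1, [mu] lies below [P]: this gives both the finiteness of [mu] and the
   domination of [Q] by [P]. *)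
have muP B : measurable B -> (mu B <= P B)%E.
  move=> mB; rewrite muE -[leRHS]mule1 -sumc -[P B in leRHS]fineK ?fin_num_measure//.
  rewrite -nneseriesZl//; apply: lee_nneseries => k _.
    by move=> _; rewrite mule_ge0// lee_fin.
  rewrite fineK ?fin_num_measure// muleC lee_wpmul2r ?lee_fin//.
  by rewrite le_measure ?inE//; exact: measurableI.
(* Each weight is positive, so a [mu]-null set meets every [A_ k] in a [P]-null set, and the [A_ k]
   cover the space up to a [P]-null set. *)
have mu0P B : measurable B -> mu B = 0%E -> P B = 0%E.
  move=> mB muB0.
  have PBA k : P (B `&` A_ k) = 0%E.
    have : ((c k)%:num%:E * P (B `&` A_ k) <= 0)%E.
      rewrite -muB0 muE (@nneseriesD1 _ _ k)//.
        by rewrite leeDl// nneseries_ge0// => n _ _; rewrite mule_ge0// lee_fin.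
      by move=> n _; rewrite mule_ge0// lee_fin.
    rewrite pmule_rle0 ?lte_fin// => [PB|]; first by apply/eqP; rewrite -measure_le0.
    by rewrite divr_gt0// ltr0n expn_gt0.
  apply: measure_negligible => //.
  apply: (@negligibleS _ _ _ _ (\bigcup_k (B `&` A_ k) `|` ~` \bigcup_k A_ k)).
    rewrite -setI_bigcupr => x Bx.
    by have [Ax|nAx] := pselect ((\bigcup_k A_ k) x); [left|right].
  apply: negligibleU.
    apply: negligible_bigcup => k.
    by apply/negligibleP; [exact: measurableI|exact: PBA].
  by apply/negligibleP => //; apply: measurableC; exact: bigcup_measurable.
have int_mu f : measurable_fun [set: T] f -> (forall x, 0 <= f x)%E ->
    (\int[mu]_x f x = \sum_(k <oo) (c k)%:num%:E * \int[P]_(x in A_ k) f x)%E.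
  move=> mf f0; rewrite ge0_integral_measure_series//; apply: eq_eseriesr => k _.
  by rewrite ge0_integral_mscale// integral_mrestr.
have muT_gt0 : (0 < mu setT)%E.
  rewrite lt0e measure_ge0 andbT; apply/negP => /eqP /(mu0P _ measurableT).
  by rewrite probability_setT => /eqP; rewrite onee_eq0.
have muT_fin : mu setT \is a fin_num.
  rewrite ge0_fin_numE// (le_lt_trans (muP _ measurableT))//.
  by rewrite probability_setT ltry.
have r_gt0 : 0 < (fine (mu setT))^-1.
  by rewrite invr_gt0 fine_gt0// muT_gt0 -ge0_fin_numE.
pose r : {nonneg R} := NngNum (ltW r_gt0).
(* The second argument of [mnormalize] is the default for total mass 0 or infinity; [muT_gt0] and
   [muT_fin] exclude both cases. *)
pose Q : probability T R := mnormalize mu P.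
have QE B : Q B = mscale r mu B.
  rewrite /Q/= /mnormalize ifF; first by rewrite /mscale muleC.
  by rewrite gt_eqF//=; apply/negbTE; rewrite -ltey -ge0_fin_numE.
exists Q; split.
  split; apply/null_content_dominatesP => B mB B0.
    have muB0 : mu B = 0%E by apply/eqP; rewrite -measure_le0 -B0; exact: muP.
    by apply: etrans (QE B) _; rewrite /mscale muB0 mule0.
  apply: mu0P => //; move: B0 => /(etrans (esym (QE B)))/eqP.
  by rewrite /mscale mule_eq0 eqe gt_eqF//= => /eqP.
move=> f mf f0 [M fM] fA.
have -> : (fun n => \int[Q]_x f n x)%E = (fun n => (r%:num)%:E * \int[mu]_x f n x)%E.
  apply/funext => n; rewrite -ge0_integral_mscale//.
  by apply: eq_measure_integral => B mB _; exact: QE.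
rewrite -[X in _ --> X](mule0 (r%:num)%:E); apply: cvgeZl => //.
under eq_fun do rewrite int_mu//.
have M0 : (0 <= M%:E)%E by apply: le_trans (fM 0%N); exact: integral_ge0.
apply: (@nneseries_dominated_cvg0 _ _ (fun k => M%:E * (c k)%:num%:E)%E).
- move=> n k; rewrite mule_ge0 ?lee_fin ?integral_ge0//=.
  rewrite [leRHS]muleC lee_wpmul2l ?lee_fin// (le_trans _ (fM n))//.
  exact: ge0_subset_integral.
- by rewrite nneseriesZl// sumc mule1 ltry.
- move=> k; rewrite -[X in _ --> X](mule0 (c k)%:num%:E).
  exact: cvgeZl.
Qed.

(** The density [g] of [P] with respect to [Q] is finite everywhere, so the sets where [g] is at
    most n increase to the whole space and their [P]-measure tends to 1. On such a set [f * g] is at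
    most n times [f], whatever [f] is. *)
Lemma truncated_density (d : measure_display) (T : measurableType d)
    (R : realType) (P Q : probability T R) (e : R) : P `<< Q -> 0 < e ->
  exists2 A, measurable A /\ ((1 - e)%:E < P A)%E &
    exists2 N : R, 0 <= N & forall f : T -> \bar R,
      measurable_fun [set: T] f -> (forall x, 0 <= f x)%E ->
      (\int[P]_(x in A) f x <= N%:E * \int[Q]_x f x)%E.
Proof.
move=> PQ e0; pose g := Radon_Nikodym_SigmaFinite.f P Q.
have g0 x : (0 <= g x)%E := Radon_Nikodym_SigmaFinite.f_ge0 PQ x.
have gfin x : g x \is a fin_num := Radon_Nikodym_SigmaFinite.f_fin_num PQ x.
have mg : measurable_fun [set: T] g.
  exact: measurable_int (Radon_Nikodym_SigmaFinite.f_integrable PQ).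
pose A n := [set x | g x <= n%:R%:E]%E.
have mA n : measurable (A n).
  by rewrite -[A n]setTI; exact: emeasurable_fun_infty_c.
have AT : \bigcup_n A n = setT.
  apply/seteqP; split => // x _; exists (Num.truncn (fine (g x))).+1 => //=.
  by rewrite /A/= -(fineK (gfin x)) lee_fin ltW// truncnS_gt.
have : P \o A @ \oo --> P (\bigcup_n A n).
  apply: nondecreasing_cvg_mu => //; first by rewrite AT.
  move=> m n mn; apply/subsetPset => x /le_trans; apply.
  by rewrite lee_fin ler_nat.
rewrite AT probability_setT.
move=> PA1.
have [n An] : exists n, ((1 - e)%:E < P (A n))%E.
  apply/not_existsP => PAe.
  have : (1%:E <= (1 - e)%:E)%E.
    apply: cvge_le PA1; apply: nearW => n; rewrite leNgt; apply/negP; exact: PAe.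
  by rewrite lee_fin lerDl oppr_ge0 leNgt e0.
exists (A n) => //; exists n%:R => // f mf f0.
have -> : (\int[P]_(x in A n) f x = \int[Q]_(x in A n) (f x * g x))%E.
  rewrite Radon_Nikodym_SigmaFinite.change_of_variables//.
  exact: measurable_funTS.
rewrite -ge0_integralZl_EFin//.
apply: (@le_trans _ _ (\int[Q]_(x in A n) (n%:R%:E * f x))%E).
  apply: ge0_le_integral => //.
  - by move=> x _; rewrite mule_ge0.
  - by apply: measurable_funTS; exact: emeasurable_funM.
  - by apply: measurable_funTS; exact: measurable_funeM.
  - by move=> x Ax; rewrite muleC lee_wpmul2r.
apply: ge0_subset_integral => //; first exact: measurable_funeM.
by move=> x _; rewrite mule_ge0.
Qed.

Lemma expectation_restrict (d : measure_display) (T : measurableType d)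
    (R : realType) (P : probability T R) (A : set T) (f : T -> R) :
  ('E_P[(fun w => f w * \1_A w)%R] = \int[P]_(w in A) (f w)%:E)%E.
Proof.
rewrite unlock [RHS]integral_mkcond epatch_indic.
by apply: eq_integral => w _; rewrite EFinM.
Qed.

Lemma measurable_Lspace1 (d : measure_display) (T : measurableType d)
    (R : realType) (mu : {measure set T -> \bar R}) (X : LspaceType1 mu) :
  measurable_fun [set: T] (fun w => (X w : R)).
Proof. exact: (measurable_funP (repr (X : aeEqMfun _ _))). Qed.

(** By the triangle inequality the supremum over [K] plus the norm of [X] is a bound; it supplies
    the constant [M] of [equivalent_mixture]. *)
Lemma L1_dist_expectation_le (d : measure_display) (T : measurableType d)
    (R : realType) (P : probability T R) (K : set (LspaceType1 P))
    (X : LspaceType1 P) : L1_bounded K ->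
  exists M : R, forall Y : LspaceType1 P, K Y ->
    (\int[P]_w (`|(Y w : R) - (X w : R)|)%:E <= M%:E)%E.
Proof.
move=> Kb; pose s := ereal_sup [set 'E_P[(fun w => `|(Y w : R)|)%R]%E | Y in K].
have mX := @measurable_Lspace1 _ _ _ P.
have Xfin : (\int[P]_w `|(X w : R)|%:E < +oo)%E.
  by have := @Lebesgue_finite _ _ _ _ _ _ X; rewrite /finite_norm Lnorm1.
(* For empty [K] the supremum [s] is -oo, so this case is treated apart. *)
have [[Y0 KY0]|K0] := pselect (K !=set0); last first.
  by exists 0 => Y KY; exfalso; apply: K0; exists Y.
have s0 : (0 <= s)%E.
  apply: ereal_sup_ge; exists 'E_P[(fun w => `|(Y0 w : R)|)%R]%E; first by exists Y0.
  exact: expectation_ge0.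
exists (fine (s + \int[P]_w `|(X w : R)|%:E)%E) => Y KY.
rewrite fineK; last first.
  by rewrite fin_numD !ge0_fin_numE ?Xfin ?integral_ge0// andbT; exact: Kb.
apply: (@le_trans _ _ (\int[P]_w (`|(Y w : R)|%:E + `|(X w : R)|%:E))%E).
  apply: ge0_le_integral => //.
  - by apply/measurable_EFinP/measurableT_comp => //; exact: measurable_funB.
  - by apply: emeasurable_funD; apply/measurable_EFinP/measurableT_comp.
  - by move=> w _; rewrite -EFinD lee_fin ler_normB.
rewrite ge0_integralD//; [|by apply/measurable_EFinP/measurableT_comp..].
rewrite leeD2r//; apply: ereal_sup_ubound; exists Y => //.
by rewrite unlock.
Qed.

Theorem proposition2p2 (R : realType) (d : measure_display)
    (T : measurableType d) (P : probability T R)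
    (K S : set (LspaceType1 P)) :
  nonatomic P -> L1_convex K -> L1_bounded K -> S !=set0 ->
  [<->
    (exists Q : probability T R, mutually_ac Q P /\
      forall (X_ : nat -> LspaceType1 P) (X : LspaceType1 P),
        (forall n, K (X_ n)) -> S X -> cvg_in_probability P X_ X ->
        (fun n => 'E_Q[(fun w => `|(X_ n w : R) - (X w : R)|)%R])%E @ \oo --> 0%E);
    (forall e : R, 0 < e ->
      exists A : set T, [/\ measurable A, ((1 - e)%:E < P A)%E &
        forall (X_ : nat -> LspaceType1 P) (X : LspaceType1 P),
          (forall n, K (X_ n)) -> S X -> cvg_in_probability P X_ X ->
          (fun n => 'E_P[(fun w => `|(X_ n w : R) - (X w : R)| * \1_A w)%R])%E
            @ \oo --> 0%E]);
    (forall A : set T, measurable A -> (0 < P A)%E ->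
      exists B : set T, [/\ measurable B, B `<=` A, (0 < P B)%E &
        forall (X_ : nat -> LspaceType1 P) (X : LspaceType1 P),
          (forall n, K (X_ n)) -> S X -> cvg_in_probability P X_ X ->
          (fun n => 'E_P[(fun w => `|(X_ n w : R) - (X w : R)| * \1_B w)%R])%E
            @ \oo --> 0%E])].
Proof.
move=> _ _ Kb _.
have mXY (X Y : LspaceType1 P) :
    measurable_fun [set: T] (fun w => `|(X w : R) - (Y w : R)|%:E).
  apply/measurable_EFinP/measurableT_comp => //.
  by apply: measurable_funB; exact: measurable_Lspace1.
(* The property of sets shared by (2) and (3), with the indicator replaced by integration over [A],
   where monotonicity and additivity in [A] are available. *)
pose restrict_cvg0 A := forall (X_ : nat -> LspaceType1 P) (X : LspaceType1 P),
  (forall n, K (X_ n)) -> S X -> cvg_in_probability P X_ X ->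
  (fun n => \int[P]_(w in A) `|(X_ n w : R) - (X w : R)|%:E)%E @ \oo --> 0%E.
have restrict_cvg0S A B : measurable A -> measurable B -> A `<=` B ->
    restrict_cvg0 B -> restrict_cvg0 A.
  move=> mA mB AB gB X_ X KX SX XX.
  apply: (squeeze_cvge _ (cvg_cst 0%E) (gB X_ X KX SX XX)).
  apply: nearW => n; rewrite integral_ge0//=; apply: ge0_subset_integral => //.
  exact: measurable_funTS.
have restrict_cvg0P A : restrict_cvg0 A <->
    forall (X_ : nat -> LspaceType1 P) (X : LspaceType1 P),
      (forall n, K (X_ n)) -> S X -> cvg_in_probability P X_ X ->
      (fun n => 'E_P[(fun w => `|(X_ n w : R) - (X w : R)| * \1_A w)%R])%E
        @ \oo --> 0%E.
  split=> gA X_ X KX SX XX; last have := gA X_ X KX SX XX;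
    under eq_fun do rewrite expectation_restrict; last exact.
  exact: gA.
split; last split.
(* (1) => (2): the restricted [P]-integral is squeezed between 0 and [N] times the
   [Q]-expectation. *)
- move=> [Q [[_ PQ] QX]] e e0.
  have [A [mA PA] [N N0 AN]] := truncated_density PQ e0.
  exists A; split=> //; apply/restrict_cvg0P => X_ X KX SX XX.
  have := QX X_ X KX SX XX; rewrite unlock => /(@cvgeZl _ _ _ _ _ N%:E).
  rewrite mule0 => /(_ isT); apply: squeeze_cvge (cvg_cst 0%E).
  by apply: nearW => n; rewrite integral_ge0//= AN.
- move=> h A mA PA0.
  have finA : P A \is a fin_num by rewrite fin_num_measure.
  (* With e = P(A), the set [C] satisfies P(C) > 1 - P(A) = P(~[A). Were]A[and]C[to meet in a null
     set, P(C) would be at most P(~] A). *)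
  have [|C [mC PC /restrict_cvg0P gC]] := h (fine (P A)).
    by rewrite fine_gt0// PA0 -ge0_fin_numE.
  exists (A `&` C); split; [exact: measurableI|exact: subIsetl| |].
    rewrite lt0e measure_ge0 andbT; apply/eqP => PAC0.
    have : (P C <= P (A `&` C) + P (~` A))%E.
      apply: (@le_trans _ _ (P (A `&` C `|` ~` A))); last first.
        by apply: measureU2; [exact: measurableI|exact: measurableC].
      rewrite le_measure ?inE//.
        by apply: measurableU; [exact: measurableI|exact: measurableC].
      by move=> w Cw; have [Aw|nAw] := pselect (A w); [left|right].
    rewrite PAC0 add0e probability_setC//.
    by move: PC; rewrite EFinB fineK// ltNge => /negP.
  by apply/restrict_cvg0P; apply: restrict_cvg0S gC => //; exact: measurableI.
- move=> h.
  (* (3) => (1): the class of sets to exhaust consists of those with [restrict_cvg0]; its stability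
     under disjoint unions is the additivity of limits, and (3) provides a member of positive
     measure inside every set of positive measure. *)
  have [||||A_ [GA PA]] := @exhaustion _ _ _ P
    [set A | measurable A /\ restrict_cvg0 A].
  - by move=> A [].
  - split=> // X_ X KX SX XX; under eq_fun do rewrite integral_set0.
    exact: cvg_cst.
  - move=> A B [mA gA] [mB gB] AB0; split; first exact: measurableU.
    move=> X_ X KX SX XX.
    under eq_fun => n.
      rewrite ge0_integral_setU//; [|exact: measurable_funTS|exact/eqP].
      over.
    have := cvgeD _ (gA X_ X KX SX XX) (gB X_ X KX SX XX).
    by rewrite adde0; exact.
  - move=> A mA PA0; have [B [mB BA PB gB]] := h A mA PA0.
    by exists B; split => //; split => //; exact/restrict_cvg0P.
  have [|Q [QP Qf]] := equivalent_mixture _ PA; first by move=> k; have [] := GA k.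
  exists Q; split => // X_ X KX SX XX; rewrite unlock; apply: Qf.
  - by move=> n; exact: mXY.
  - by move=> n w; rewrite lee_fin.
  - have [M XM] := L1_dist_expectation_le X Kb.
    by exists M => n; exact: XM.
  - by move=> k; have [_ gk] := GA k; exact: gk.
Qed.
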